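(* If $f:H=\prod_{i\in I} H_i\to K$ is a surjective homomorphism of groups, and $K$ has chain condition on almost direct factors, then there exist finitely many ultrafilters $\mathcal{U}_0,\dots,\mathcal{U}_{n-1}$ on $I$ such that the composite map $H\to K\to K/Z(K)$ (of $f$ with the quotient map) factors through the natural map $H\to H/\mathcal{U}_0\times\dots\times H/\mathcal{U}_{n-1}$.
   Context: $Z(K)$ denotes the center of the group $K$. Two normal subgroups $K_0,K_1$ of $K$ are called almost direct factors of $K$ if each is the centralizer in $K$ of the other and $K_0K_1=K$; each such subgroup is called an almost direct factor of $K$. $K$ has chain condition on almost direct factors if every ascending chain of almost direct factors of $K$ terminates (equivalently, every descending chain of such subgroups terminates). An ultrafilter on $I$ is a maximal proper filter of subsets of $I$. For an ultrafilter $\mathcal{U}$ on $I$, $H/\mathcal{U}$ denotes the ultraproduct: the quotient of $\prod_{i\in I} H_i$ by the relation $(a_i)\sim(b_i)$ iff $\{i\mid a_i=b_i\}\in\mathcal{U}$, with induced group structure. The case $n=0$ is allowed, the empty product being the trivial group. *)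

(* Defs.v *)
(* Groups are the possibly infinite [groupType] of boot/monoid.v. Its choiceType
   structure costs no generality, since [gen_eqMixin] and [gen_choiceMixin]
   provide one on every type. *)
From HB Require Import structures.
From mathcomp Require Import all_boot.
From mathcomp Require Import boolp classical_sets filter.

Set Implicit Arguments.
Unset Strict Implicit.
Unset Printing Implicit Defensive.

Local Open Scope classical_set_scope.
Local Open Scope group_scope.
Local Open Scope quotient_scope.

Notation group_hom := UMagmaMorphism.type.

Section Subgroups.
Variable G : groupType.
Implicit Types A B : set G.

(* [group_closed] is the library's "contains 1 and is closed under division". *)
Definition normal_subgroup A : Prop :=
  group_closed [in A] /\ (forall x y, A x -> A (x ^ y)).

Definition centralizer A : set G := [set x | forall y, A y -> commute x y].

Definition center : set G := centralizer setT.

Definition almost_direct_factors A B : Prop :=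
  [/\ normal_subgroup A, normal_subgroup B,
      A = centralizer B, B = centralizer A
    & [set x * y | x in A & y in B] = setT].

Definition almost_direct_factor A : Prop :=
  exists B, almost_direct_factors A B.

Definition chain_condition : Prop :=
  forall A : nat -> set G,
    (forall n, almost_direct_factor (A n)) ->
    (forall n, A n `<=` A n.+1) ->
    exists m, forall n, (m <= n)%N -> A n = A m.

Lemma center_normal : normal_subgroup center.
Proof.
split; last by move=> x y xZ; rewrite conjgE (xZ y I) mulKg.
split=> [|x y]; rewrite !inE; first by move=> y _; rewrite /commute mul1g mulg1.
move=> xZ yZ z _; rewrite /commute -mulgA.
have -> : y^-1 * z = z * y^-1.
  by apply: (mulgI y); rewrite mulVKg mulgA (yZ z I) mulgK.
by rewrite !mulgA (xZ z I).
Qed.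

End Subgroups.
Arguments center : clear implicits.
Arguments center_normal : clear implicits.
Arguments chain_condition : clear implicits.

Record congruence (G : groupType) := Congruence {
  cong_rel :> equiv_rel G;
  congM : forall x x' y y',
    cong_rel x x' -> cong_rel y y' -> cong_rel (x * y) (x' * y')
}.

Section QuotientByCongruence.
Variables (G : groupType) (e : congruence G).

Definition cong_quot := {eq_quot e}.
HB.instance Definition _ := EqQuotient.on cong_quot.
HB.instance Definition _ := Choice.on cong_quot.

Definition cong_pi : G -> cong_quot := \pi_cong_quot.

Lemma cong_piP x y : cong_pi x = cong_pi y <-> e x y.
Proof. by split=> /eqmodP. Qed.

Definition quot_one : cong_quot := cong_pi 1.
Definition quot_mul (a b : cong_quot) : cong_quot := cong_pi (repr a * repr b).
Definition quot_inv (a : cong_quot) : cong_quot := cong_pi (repr a)^-1.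

Lemma repr_cong_pi x : e (repr (cong_pi x)) x.
Proof. by apply/cong_piP; rewrite /cong_pi reprK. Qed.

Lemma quot_ind (P : cong_quot -> Prop) : (forall x, P (cong_pi x)) -> forall a, P a.
Proof. by move=> Pp a; rewrite -[a]reprK; exact: Pp. Qed.

Lemma quot_mulE x y : quot_mul (cong_pi x) (cong_pi y) = cong_pi (x * y).
Proof. by apply/cong_piP/congM; exact: repr_cong_pi. Qed.

Lemma quot_mulA : associative quot_mul.
Proof.
elim/quot_ind=> x; elim/quot_ind=> y; elim/quot_ind=> z.
by rewrite !quot_mulE mulgA.
Qed.
Lemma quot_mul1 : left_id quot_one quot_mul.
Proof. by elim/quot_ind=> x; rewrite quot_mulE mul1g. Qed.
Lemma quot_mulr1 : right_id quot_one quot_mul.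
Proof. by elim/quot_ind=> x; rewrite quot_mulE mulg1. Qed.
Lemma quot_mulV : left_inverse quot_one quot_inv quot_mul.
Proof. by move=> a; rewrite -{2}[a]reprK quot_mulE mulVg. Qed.
Lemma quot_mulrV : right_inverse quot_one quot_inv quot_mul.
Proof. by move=> a; rewrite -{1}[a]reprK quot_mulE mulgV. Qed.

HB.instance Definition _ := isGroup.Build cong_quot
  quot_mulA quot_mul1 quot_mulr1 quot_mulV quot_mulrV.

Lemma cong_pi_monoid_morphism : monoid_morphism cong_pi.
Proof. by split=> // x y; rewrite [RHS]quot_mulE. Qed.
HB.instance Definition _ :=
  isUMagmaMorphism.Build G cong_quot cong_pi cong_pi_monoid_morphism.

End QuotientByCongruence.

Section QuotientByNormal.
Variables (G : groupType) (N : set G) (nN : normal_subgroup N).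

Definition normal_rel : rel G := fun x y => `[< N (x^-1 * y) >].

Lemma normal1 : N 1.
Proof. by case: nN => -[]; rewrite inE. Qed.

Lemma normalM x y : N x -> N y -> N (x * y).
Proof. by case: nN => /group_closedM NM _ Nx Ny; have := NM x y; rewrite !inE; exact. Qed.

Lemma normalV x : N x -> N x^-1.
Proof. by case: nN => /group_closedV NV _ Nx; have := NV x; rewrite !inE; exact. Qed.

Lemma normal_equiv_class : equiv_class_of normal_rel.
Proof.
split=> [x|x y|y x z].
- by apply/asboolP; rewrite mulVg; exact: normal1.
- by apply/asbool_equiv_eq; split=> /normalV; rewrite invgM invgK.
- move=> /asboolP xy /asboolP yz; apply/asboolP.
  by have := normalM xy yz; rewrite mulgA mulgK.
Qed.

Lemma normal_congM x x' y y' :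
  normal_rel x x' -> normal_rel y y' -> normal_rel (x * y) (x' * y').
Proof.
move=> /asboolP/(proj2 nN _ y) xx' /asboolP yy'; apply/asboolP.
by have := normalM xx' yy'; rewrite conjgE invgM !mulgA mulgK.
Qed.

Definition normal_cong : congruence G :=
  @Congruence G (EquivRelPack normal_equiv_class) normal_congM.

End QuotientByNormal.

Definition quot_center (K : groupType) : groupType :=
  cong_quot (normal_cong (center_normal K)).

Definition to_quot_center (K : groupType) : group_hom K (quot_center K) :=
  cong_pi (normal_cong (center_normal K)).

Section Product.
Variables (I : Type) (H : I -> groupType).

Definition prodg : Type := forall i, H i.
HB.instance Definition _ := gen_eqMixin prodg.
HB.instance Definition _ := gen_choiceMixin prodg.

Definition prodg_one : prodg := fun=> 1.
Definition prodg_mul (a b : prodg) : prodg := fun i => a i * b i.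
Definition prodg_inv (a : prodg) : prodg := fun i => (a i)^-1.

Lemma prodg_mulA : associative prodg_mul.
Proof. by move=> a b c; apply: functional_extensionality_dep => i; exact: mulgA. Qed.
Lemma prodg_mul1 : left_id prodg_one prodg_mul.
Proof. by move=> a; apply: functional_extensionality_dep => i; exact: mul1g. Qed.
Lemma prodg_mulr1 : right_id prodg_one prodg_mul.
Proof. by move=> a; apply: functional_extensionality_dep => i; exact: mulg1. Qed.
Lemma prodg_mulV : left_inverse prodg_one prodg_inv prodg_mul.
Proof. by move=> a; apply: functional_extensionality_dep => i; exact: mulVg. Qed.
Lemma prodg_mulrV : right_inverse prodg_one prodg_inv prodg_mul.
Proof. by move=> a; apply: functional_extensionality_dep => i; exact: mulgV. Qed.

HB.instance Definition _ := isGroup.Build prodg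
  prodg_mulA prodg_mul1 prodg_mulr1 prodg_mulV prodg_mulrV.

End Product.

Section Tuple.
Variables (G : groupType) (J : Type) (H : J -> groupType).
Variable p : forall j, group_hom G (H j).

Definition tuple_fun (x : G) : prodg H := fun j => p j x.

Lemma tuple_fun_monoid_morphism : monoid_morphism tuple_fun.
Proof.
split=> [|x y]; apply: functional_extensionality_dep => j.
  exact: gmulf1.
exact: gmulfM.
Qed.
HB.instance Definition _ := isUMagmaMorphism.Build G (prodg H)
  tuple_fun tuple_fun_monoid_morphism.

Definition tuple_hom : group_hom G (prodg H) := tuple_fun.
End Tuple.

Record ultrafilter (I : Type) := Ultrafilter {
  ultra_sets :> set_system I;
  ultraP : UltraFilter ultra_sets
}.

Section Ultraproduct.
Variables (I : Type) (H : I -> groupType) (U : ultrafilter I).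

Definition ultra_rel : rel (prodg H) :=
  fun a b => `[< (U : set_system I) [set i | a i = b i] >].

Let UF : Filter U := @filter_filter _ _ (@ultra_proper _ _ (ultraP U)).
Local Existing Instance UF.

Lemma ultra_equiv_class : equiv_class_of ultra_rel.
Proof.
split=> [a|a b|b a c].
- by apply/asboolP; apply: (filterS _ filterT) => i _.
- by apply/asbool_equiv_eq; split; apply: filterS => i /= /esym.
- move=> /asboolP ab /asboolP bc; apply/asboolP.
  by apply: (filterS2 _ _ ab bc) => i /= -> ->.
Qed.

Lemma ultra_congM (a a' b b' : prodg H) :
  ultra_rel a a' -> ultra_rel b b' -> ultra_rel (a * b) (a' * b').
Proof.
move=> /asboolP aa' /asboolP bb'; apply/asboolP.
apply: (filterS2 _ _ aa' bb') => i /= ai bi.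
by rewrite /mul /= /prodg_mul ai bi.
Qed.

Definition ultra_cong : congruence (prodg H) :=
  @Congruence (prodg H) (EquivRelPack ultra_equiv_class) ultra_congM.

Definition ultraproduct : groupType := cong_quot ultra_cong.

Definition to_ultraproduct : group_hom (prodg H) ultraproduct :=
  cong_pi ultra_cong.

End Ultraproduct.

(* Main.v *)
(* Call S ⊆ I negligible when f maps the elements of H supported on S into Z(K).
   Elements supported on S commute with those supported off S, and f is onto, so
   the centralizers of f(H_S) and f(H_{I \ S}) are almost direct factors; the
   chain condition then says that every ascending sequence of subsets of I has a
   step with negligible difference.  Hence I cannot be split forever into
   non-negligible pieces: modulo negligible sets it is a finite union of atoms.
   Each atom A gives the ultrafilter of all S such that S ∩ A is not negligible,
   and an element of H that is trivial modulo all of these has negligible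
   support.  As the atoms are disjoint, H maps onto the product of the
   ultraproducts, so the factor map is a homomorphism defined on all of it. *)
From HB Require Import structures.
Require Import Defs.
From mathcomp Require Import all_boot.
From mathcomp Require Import boolp classical_sets filter.

Set Implicit Arguments.
Unset Strict Implicit.
Unset Printing Implicit Defensive.

(** * Ideals of sets, atoms and ultrafilters *)

Section Ideals.
Local Open Scope classical_set_scope.
Variables (I : Type) (N : set_system I).
Hypothesis N0 : N set0.
Hypothesis NS : forall S T, S `<=` T -> N T -> N S.
Hypothesis NU : forall S T, N S -> N T -> N (S `|` T).

(** For each [S], exactly one of [S] and its complement meets [A] outside the ideal: not neither,
    since [A] is the union of the two traces, and not both, since [A] is an atom. *)
Lemma atom_ultrafilter (A : set I) :
    ~ N A -> (forall S, S `<=` A -> N S \/ N (A `\` S)) ->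
  UltraFilter [set S | ~ N (S `&` A)].
Proof.
move=> NnA atomA; set F := [set S | _].
have FC S : ~ F S -> F (~` S).
  move=> /contrapT NSA NCA; apply: NnA; apply: (NS _ (NU NSA NCA)) => i Ai.
  by have [Si|Si] := pselect (S i); [left|right].
have NF S : F S -> N (~` S `&` A).
  move=> FS; have [//|] := atomA (S `&` A) (@subIsetr _ S A).
  by apply: NS => i [nSi Ai]; split=> // -[].
have PF : ProperFilter F.
  split; first by rewrite /F /= set0I; apply.
  split=> [|S T FS FT NST|S T ST FS NT].
  - by rewrite /F /= setTI.
  - apply: FS; apply: (NS _ (NU NST (NF _ FT))) => i [Si Ai].
    by have [Ti|Ti] := pselect (T i); [left|right].
  - by apply: FS; apply: NS NT; exact: setSI.
split=> // G PG FG; apply/seteqP; split=> [S GS|]; last exact: FG.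
apply: contrapT => /FC/FG GCS; apply: (@filter_not_empty _ G).
by rewrite -(setICr S); exact: filterI.
Qed.

(* The sets [B j] are kept disjoint because distinct ultrafilters are needed for
   the map to the product of ultraproducts to be onto. *)
Definition finitely_atomic (A : set I) : Prop :=
  exists (J : finType) (U : J -> ultrafilter I) (B : J -> set I),
    [/\ forall j, B j `<=` A,
        forall j, ultra_sets (U j) (B j),
        forall i j k, B j i -> B k i -> j = k
      & forall S, S `<=` A -> ~ N S -> exists j, ultra_sets (U j) S].

Lemma finitely_atomicU (A A' : set I) : A `&` A' = set0 ->
  finitely_atomic A -> finitely_atomic A' -> finitely_atomic (A `|` A').
Proof.
move=> AA' [J [U [B [BA UB Binj UN]]]] [J' [U' [B' [BA' UB' Binj' UN']]]].
have AnA' i : A i -> A' i -> False.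
  by move=> Ai A'i; have : (A `&` A') i by []; rewrite AA'.
exists (J + J')%type, (fun j => match j with inl j => U j | inr j => U' j end).
exists (fun j => match j with inl j => B j | inr j => B' j end); split.
- by case=> j i; [move/BA; left | move/BA'; right].
- by case.
- move=> i [j|j] [k|k] Bj Bk.
  + by congr inl; exact: (Binj _ _ _ Bj Bk).
  + by case: (AnA' i (BA _ _ Bj) (BA' _ _ Bk)).
  + by case: (AnA' i (BA _ _ Bk) (BA' _ _ Bj)).
  + by congr inr; exact: (Binj' _ _ _ Bj Bk).
- move=> S SA NnS; have [NSA|NSA] := pselect (N (S `&` A)); last first.
    have [j UjS] := UN _ (@subIsetr _ _ _) NSA; exists (inl j).
    have ? := ultraP (U j); exact: (filterS (@subIsetl _ _ _) UjS).
  have NSA' : ~ N (S `&` A').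
    by move=> /(NU NSA); rewrite -setIUr setIidl.
  have [j UjS] := UN' _ (@subIsetr _ _ _) NSA'; exists (inr j).
  have ? := ultraP (U' j); exact: (filterS (@subIsetl _ _ _) UjS).
Qed.

Lemma finitely_atomic_negligible (A : set I) : N A -> finitely_atomic A.
Proof.
move=> NA; exists void, (of_void _), (of_void _).
by split=> [[]|[]|i []|S /NS SN /(_ (SN NA))[]].
Qed.

Lemma finitely_atomic_atom (A : set I) :
  ~ N A -> (forall S, S `<=` A -> N S \/ N (A `\` S)) -> finitely_atomic A.
Proof.
move=> NnA atomA; pose U := Ultrafilter (atom_ultrafilter NnA atomA).
exists unit, (fun=> U), (fun=> A); split.
- by move=> _; exact: subset_refl.
- by move=> _; rewrite /U /= setIid.
- by move=> i [] [].
- by move=> S SA NnS; exists tt => /=; rewrite setIidl.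
Qed.

(** Such an [A] is not an atom, so it is a disjoint union of two sets outside [N]. By
    [finitely_atomicU] one of them is not finitely atomic, and it serves as [B]. *)
Lemma split_not_finitely_atomic (A : set I) : ~ finitely_atomic A ->
  exists B, [/\ B `<=` A, ~ finitely_atomic B & ~ N (A `\` B)].
Proof.
move=> nA; apply: contrapT => noB; apply: (nA).
apply: finitely_atomic_atom => [|S SA]; first by move/finitely_atomic_negligible.
have [|NnS] := pselect (N S); first by left.
have [|NnAS] := pselect (N (A `\` S)); first by right.
have SE : A `\` (A `\` S) = S by rewrite setDD setIidr.
have [aS|naS] := pselect (finitely_atomic S); last by case: noB; exists S.
have [aAS|naAS] := pselect (finitely_atomic (A `\` S)).
  case: nA; rewrite -(setDUK SA); apply: finitely_atomicU => //.
  by rewrite setIDA setIC -setIDA setDv setI0.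
by case: noB; exists (A `\` S); split=> //; rewrite SE.
Qed.

Lemma ascending_finitely_atomic :
    (forall T : nat -> set I, (forall n, T n `<=` T n.+1) ->
      exists n, N (T n.+1 `\` T n)) ->
  finitely_atomic setT.
Proof.
move=> asc; apply: contrapT => naT.
have /choice[next nextP] (A : set I) : exists B, ~ finitely_atomic A ->
    [/\ B `<=` A, ~ finitely_atomic B & ~ N (A `\` B)].
  have [|/split_not_finitely_atomic[B]] := pselect (finitely_atomic A).
    (* A dummy value, so that [next] is total. *)
    by exists A.
  by exists B.
pose A n := iter n next setT.
have nA n : ~ finitely_atomic (A n) by elim: n => // n /nextP[].
(* The [A n] descend, so their complements ascend, with the same successive differences, none of
   them in [N]. *)
have [n] : exists n, N (~` A n.+1 `\` ~` A n).
  by apply: asc => n; apply: subsetC; have [] := nextP _ (nA n).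
by rewrite setDE setCK setIC -setDE; have [] := nextP _ (nA n).
Qed.

End Ideals.

(** * Factoring homomorphisms, and centralizers *)

Section Groups.
Local Open Scope classical_set_scope.
Local Open Scope group_scope.

(** For a section [s] of [p], the map [q \o s] is multiplicative because [s (y * z)] and [s y * s z]
    have the same image under [p]. *)
Lemma factor_surjective (G P Q : groupType) (p : group_hom G P)
    (q : group_hom G Q) :
    (forall y, exists x, p x = y) ->
    (forall x x', p x = p x' -> q x = q x') ->
  exists g : group_hom P Q, forall x, q x = g (p x).
Proof.
move=> /choice[s ps] pq; pose g y := q (s y).
have gm : monoid_morphism g.
  split=> [|y z]; first by rewrite /g -(gmulf1 (s := q)); apply: pq; rewrite ps gmulf1.
  by rewrite /g -gmulfM; apply: pq; rewrite gmulfM !ps.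
pose m := isUMagmaMorphism.Build P Q g gm.
pose gh : group_hom P Q := HB.pack g m.
by exists gh => x; apply: pq; rewrite ps.
Qed.

Lemma normal_centralizer (G : groupType) (A : set G) :
  (forall x y, A x -> A (x ^ y)) -> normal_subgroup (centralizer A).
Proof.
move=> AJ; split.
  split=> [|x y]; rewrite !inE.
    by move=> y _; exact/commute_sym/commute1.
  move=> xC yC z Az; apply/commute_sym/commuteM; first exact/commute_sym/xC.
  exact/commuteV/commute_sym/yC.
move=> x y xC z Az; have /xC := AJ z y^-1 Az.
rewrite /commute => /(congr1 (fun t => t ^ y)).
by rewrite (conjMg x) (conjMg _ x) !conjgKV.
Qed.

Lemma centralizerS (G : groupType) (A B : set G) :
  A `<=` B -> centralizer B `<=` centralizer A.
Proof. by move=> AB x xB y /AB; exact: xB. Qed.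

(** * Elements of a product supported on a set of coordinates *)

Section Support.
Variables (I : Type) (H : I -> groupType).

Definition supported (S : set I) : set (prodg H) :=
  [set h | forall i, ~ S i -> h i = 1].

Definition restrict (S : set I) (h : prodg H) : prodg H :=
  fun i => if `[< S i >] then h i else 1.

Lemma prodgME (a b : prodg H) i : (a * b) i = a i * b i.
Proof. by []. Qed.

Lemma prodgVE (a : prodg H) i : a^-1 i = (a i)^-1.
Proof. by []. Qed.

Lemma supported_restrict S h : supported S (restrict S h).
Proof. by move=> i Si; rewrite /restrict asboolF. Qed.

Lemma restrict_mul S h : restrict S h * restrict (~` S) h = h.
Proof.
apply: functional_extensionality_dep => i; rewrite prodgME /restrict.
have [Si|Si] := pselect (S i).
  by rewrite asboolT // asboolF ?mulg1 //; apply.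
by rewrite asboolF // asboolT ?mul1g.
Qed.

Lemma supportedS S T : S `<=` T -> supported S `<=` supported T.
Proof. by move=> ST h hS i Ti; apply: hS => /ST. Qed.

Lemma supportedJ S h k : supported S h -> supported S (h ^ k).
Proof. by move=> hS i /hS hi; rewrite conjgE !(prodgME, prodgVE) hi mul1g mulVg. Qed.

Lemma supported_commute S a b : supported S a -> supported (~` S) b -> commute a b.
Proof.
move=> aS bS; apply: functional_extensionality_dep => i; rewrite !prodgME.
have [Si|/aS ->] := pselect (S i); last by rewrite mulg1 mul1g.
by rewrite bS ?mulg1 ?mul1g //; apply.
Qed.

End Support.

(** * Almost direct factors of [K] and negligible sets *)

Section Image.
Variables (I : Type) (H : I -> groupType) (K : groupType).
Variable f : group_hom (prodg H) K.
Hypothesis f_surj : forall k : K, exists h : prodg H, f h = k.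

(** For surjective [f] this is the image of [supported S] times the center, by
    [factor_decomposition]. As a centralizer it is visibly monotone in [S]. *)
Definition factor (S : set I) : set K := centralizer (f @` supported (~` S)).

Definition negligible : set_system I :=
  [set S | f @` supported S `<=` center K].

Lemma image_restrict S h : (f @` supported S) (f (restrict S h)).
Proof. by exists (restrict S h); [exact: supported_restrict|]. Qed.

Lemma image_supported_factor S : f @` supported S `<=` factor S.
Proof.
move=> _ [a aS <-] _ [b bS <-].
by apply: gmulf_commute; exact: supported_commute aS bS.
Qed.

Lemma factorS S T : S `<=` T -> factor S `<=` factor T.
Proof. by move=> ST; apply/centralizerS/image_subset/supportedS/subsetC. Qed.

(** Each element of [K] is the image of a product of a part on [S] and a part off [S], and [x]
    commutes with both images. *)
Lemma factor_setC_center S x : factor S x -> factor (~` S) x -> center K x.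
Proof.
move=> xS xS' y _; have [h <-] := f_surj y.
rewrite -(restrict_mul S h) gmulfM; apply: commuteM.
  by apply: xS'; rewrite setCK; exact: image_restrict.
by apply: xS; exact: image_restrict.
Qed.

Lemma normal_factor S : normal_subgroup (factor S).
Proof.
apply: normal_centralizer => _ y [a aS <-]; have [h <-] := f_surj y.
by exists (a ^ h); [exact: supportedJ | rewrite gmulfJ].
Qed.

Lemma factor_decomposition S x : factor S x ->
  exists a z, [/\ supported S a, center K z & x = f a * z].
Proof.
move=> xS; have [h hx] := f_surj x.
exists (restrict S h), (f (restrict (~` S) h)).
split; [exact: supported_restrict| |by rewrite -gmulfM restrict_mul].
apply: (factor_setC_center (S := S)); last first.
  exact/image_supported_factor/image_restrict.
have -> : f (restrict (~` S) h) = (f (restrict S h))^-1 * x.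
  by rewrite -hx -{3}(restrict_mul S h) gmulfM mulKg.
apply: (normalM (normal_factor S) _ xS); apply: (normalV (normal_factor S)).
exact/image_supported_factor/image_restrict.
Qed.

Lemma factor_centralizer S : factor S = centralizer (factor (~` S)).
Proof.
apply/seteqP; split; last exact/centralizerS/image_supported_factor.
move=> x /factor_decomposition[a [z [aS zZ ->]]] y yS.
apply/commute_sym/commuteM; last exact/commute_sym/zZ.
by apply: yS; exists a; rewrite ?setCK.
Qed.

Lemma almost_direct_factor_factor S : almost_direct_factor (factor S).
Proof.
exists (factor (~` S)); split; try exact: normal_factor.
- exact: factor_centralizer.
- by rewrite factor_centralizer setCK.
- apply/seteqP; split=> // x _; have [h <-] := f_surj x.
  exists (f (restrict S h)).
    exact/image_supported_factor/image_restrict.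
  exists (f (restrict (~` S) h)); last by rewrite -gmulfM restrict_mul.
  exact/image_supported_factor/image_restrict.
Qed.

Lemma negligible0 : negligible set0.
Proof.
move=> _ [h h0 <-].
have -> : h = 1 by apply: functional_extensionality_dep => i; exact: h0.
by rewrite gmulf1; exact: normal1 (center_normal K).
Qed.

Lemma negligibleS S T : S `<=` T -> negligible T -> negligible S.
Proof. by move=> ST; apply: subset_trans; exact/image_subset/supportedS. Qed.

Lemma negligibleU S T : negligible S -> negligible T -> negligible (S `|` T).
Proof.
move=> nS nT _ [h hST <-]; rewrite -(restrict_mul S h) gmulfM.
apply: (normalM (center_normal K)).
  by apply: nS; exact: image_restrict.
apply: nT; exists (restrict (~` S) h) => // i Ti; rewrite /restrict.
by case: asboolP => // Si; apply: hST => -[].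
Qed.

Lemma negligible_factor_eq S T : S `<=` T -> factor T = factor S ->
  negligible (T `\` S).
Proof.
move=> ST TS x xTS; apply: (factor_setC_center (S := S)).
  rewrite -TS; apply: image_supported_factor; apply: image_subset xTS.
  by apply: supportedS => i [].
apply: image_supported_factor; apply: image_subset xTS.
by apply: supportedS => i [].
Qed.

Lemma negligible_step (T : nat -> set I) : chain_condition K ->
  (forall n, T n `<=` T n.+1) -> exists n, negligible (T n.+1 `\` T n).
Proof.
move=> chain Tasc.
have [|n|m factm] := chain (fun n => factor (T n)).
- by move=> n; exact: almost_direct_factor_factor.
- exact: factorS.
exists m; apply: negligible_factor_eq => //.
exact: factm.
Qed.

Lemma eq_quot_center (h h' : prodg H) : negligible [set i | h i <> h' i] ->
  to_quot_center K (f h) = to_quot_center K (f h').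
Proof.
move=> hh'; apply/cong_piP/asboolP; rewrite -gmulfV -gmulfM.
(* [h^-1 * h'] is supported where [h] and [h'] differ. *)
apply: hh'; exists (h^-1 * h') => // i /contrapT hi.
by rewrite prodgME prodgVE hi mulVg.
Qed.

End Image.

(** * Ultraproducts and the factor map *)

Lemma tuple_ultraproduct_surjective (I : Type) (H : I -> groupType) (J : Type)
    (U : J -> ultrafilter I) (B : J -> set I) :
    (forall j, ultra_sets (U j) (B j)) -> (forall i j k, B j i -> B k i -> j = k) ->
  forall y : prodg (fun j => ultraproduct H (U j)),
  exists h : prodg H, tuple_hom (fun j => to_ultraproduct H (U j)) h = y.
Proof.
move=> UB Binj y; pose a j : prodg H := repr (y j).
(* Glue the representatives: follow [a j] on [B j], which is consistent by disjointness, and take 1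
   off all the [B j]. *)
have hP i : {x : H i | forall j, B j i -> x = a j i}.
  apply: cid.
  have [[j Bj]|noj] := pselect (exists j, B j i).
    by exists (a j i) => k Bk; rewrite (Binj i j k).
  by exists 1 => j Bj; case: noj; exists j.
exists (fun i => sval (hP i)); apply: functional_extensionality_dep => j.
rewrite -[RHS]reprK; apply/cong_piP/asboolP.
have ? := ultraP (U j); apply: filterS (UB j) => i.
exact: (svalP (hP i)).
Qed.

End Groups.

Theorem proposition10 (I : Type) (H : I -> groupType) (K : groupType)
    (f : group_hom (prodg H) K)
    (f_surj : forall k : K, exists h : prodg H, f h = k)
    (K_chain : chain_condition K) :
  exists (n : nat) (U : 'I_n -> ultrafilter I)
         (g : group_hom (prodg (fun j : 'I_n => ultraproduct H (U j)))
                        (quot_center K)),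
    forall h : prodg H,
      to_quot_center K (f h) =
      g (tuple_hom (fun j : 'I_n => to_ultraproduct H (U j)) h).
Proof.
have [J [U [B [_ UB Binj UN]]]] : finitely_atomic (negligible f) setT.
  apply: ascending_finitely_atomic => [|S T|S T|T].
  - exact: negligible0.
  - exact: negligibleS.
  - exact: negligibleU.
  - exact: negligible_step.
(* Reindex the finite type [J] by ordinals. *)
pose U' (j : 'I_#|J|) := U (enum_val j).
exists #|J|, U'.
pose q : group_hom (prodg H) (quot_center K) := (to_quot_center K \o f)%FUN.
apply: (@factor_surjective _ _ _ _ q).
  apply: (@tuple_ultraproduct_surjective _ _ _ _ (fun j => B (enum_val j))).
    by move=> j; exact: UB.
  by move=> i j k Bj Bk; apply: enum_val_inj; exact: (Binj _ _ _ Bj Bk).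
(* If [h] and [h'] differed on a non-negligible set, it would belong to some [U j], together with
   the disjoint set where they agree. *)
move=> h h' hh'; apply: eq_quot_center => //; apply: contrapT => nD.
have [j UD] := UN _ (@subsetT _ _) nD.
have /cong_piP/asboolP UE := congr1 (fun y => y (enum_rank j)) hh'.
rewrite /U' enum_rankK in UE.
have ? := ultraP (U j); apply: (@filter_not_empty _ (ultra_sets (U j))).
by apply: filterS (filterI UD UE) => i [].
Qed.
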